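(* Let $\alpha>-1$, $d\in\widetilde{D}$ (with the convention $d_{-1}=0$), $q=(L_n^{(\alpha)})_{n\in\mathbb{N}_0}$, $r_k=r_k^\alpha$, $\widetilde{q}_k=L_k^{(\alpha)}/r_k$, and let $T=E_{L^{(\alpha+1)},d}$ regarded as an operator in $H(\widetilde{q})$ with domain $\mathcal{P}_c$. For $g=\sum_kg_k\widetilde{q}_k\in H(\widetilde{q})$: (i) $g\in D(T^* )$ iff $\sum_{k=0}^\infty\left|\bar d_kg_k+\sum_{t=0}^{k-1}(\bar d_k-\bar d_{k-1})\frac{r_tg_t}{r_k}\right|^2<\infty$; (ii) for $g\in D(T^* )$, $T^*g=\sum_{k=0}^\infty\left(\bar d_kg_k+\sum_{t=0}^{k-1}(\bar d_k-\bar d_{k-1})g_t\frac{r_t}{r_k}\right)\widetilde{q}_k$; (iii) for $s\in\mathbb{N}_0$, $\widetilde{q}_s\in D(T^* )$ iff $((\bar d_k-\bar d_{k-1})/r_k)_{k\in\mathbb{N}_0}\in\ell_2$; (iv) if $((\bar d_k-\bar d_{k-1})/r_k)_{k\in\mathbb{N}_0}\in\ell_2$, then (a) $T$ is closable, (b) $g\in D(\overline{T})$ iff $\sum_{s=0}^\infty\left|g_sd_s+\sum_{k=s+1}^\infty(d_k-d_{k-1})\frac{r_s}{r_k}g_k\right|^2<\infty$, and (c) for $g\in D(\overline{T})$, $\overline{T}g=\sum_{s=0}^\infty\left(g_sd_s+\sum_{k=s+1}^\infty(d_k-d_{k-1})\frac{r_s}{r_k}g_k\right)\widetilde{q}_s$;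 (v) for $\alpha>1$, for the differential operator $m^{\alpha+1}$ regarded in $H(\widetilde{q})$ with domain $\mathcal{P}_c$: (a) $g\in D(\overline{m^{\alpha+1}})$ iff $\sum_{s=0}^\infty\left|g_s(-2s+1)+\sum_{k=s+1}^\infty(-2)\frac{r_s}{r_k}g_k\right|^2<\infty$, and (b) for such $g$, $\overline{m^{\alpha+1}}(g)=\sum_{s=0}^\infty\left(g_s(-2s+1)+\sum_{k=s+1}^\infty(-2)\frac{r_s}{r_k}g_k\right)\widetilde{q}_s$.
   Context: $\mathcal{P}_c$ is the space of polynomials in one real variable with complex coefficients. For $\beta>-1$, $L_n^{(\beta)}(x)=\sum_{k=0}^n\frac{(-1)^k}{k!}\binom{n+\beta}{n-k}x^k$ is the generalized Laguerre polynomial and $r_k^\beta=\sqrt{\Gamma(k+\beta+1)/(k!\,\Gamma(\beta+1))}$ its norm in $L^2((0,\infty),x^\beta e^{-x}dx/\Gamma(\beta+1))$. For a sequence $Q=(Q_n)$ of polynomials with $\deg Q_n=n$, $H(Q)$ is the completion of $\mathcal{P}_c$ with respect to the inner product making $(Q_n)$ orthonormal; $g\in H(Q)$ is written $g=\sum_kg_kQ_k$, $(g_k)\in\ell_2$. $\widetilde{D}$ is the set of non-constant sequences of non-zero complex numbers. For a polynomial sequence $p$ and $d\in\widetilde{D}$, $E_{p,d}$ is the linear map on $\mathcal{P}_c$ with $E_{p,d}(p_n)=d_np_n$; $L^{(\alpha+1)}=(L_n^{(\alpha+1)})_n$. $T^*$ denotes the adjoint and $\overline{T}$ the closure. $m^{\alpha+1}$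 is defined by $(m^{\alpha+1}f)(x)=2xf''(x)+2(\alpha+2-x)f'(x)+f(x)$. *)

(* Defs.v *)
From HB Require Import structures.
From mathcomp Require Import all_boot all_order all_algebra.
From mathcomp Require Import all_classical all_reals all_analysis.
From mathcomp Require Import complex.
Set Implicit Arguments. Unset Strict Implicit. Unset Printing Implicit Defensive.
Import Order.TTheory GRing.Theory Num.Theory.
Import numFieldNormedType.Exports.
Local Open Scope classical_set_scope.
Local Open Scope ring_scope.

(* the complex numbers over R, packaged as a numClosedFieldType so that
   MathComp-Analysis' (normed) topology applies *)
Definition Cx (R : realType) : numClosedFieldType := R[i].

Section LaguerreDefs.
Context {R : realType}.
Local Notation C := (Cx R).

(* An element g = sum_k g_k q~_k of H(q~) is identified with its coordinate
   sequence (g_k) : nat -> C, which must be in l_2. *)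

Definition sqnorm (z : C) : R := complex.Re z ^+ 2 + complex.Im z ^+ 2.

Definition l2 (u : nat -> C) : Prop := cvgn (series (fun k => sqnorm (u k))).

Definition l2norm (u : nat -> C) : R :=
  Num.sqrt (limn (series (fun k => sqnorm (u k)))).

Definition ip (f g : nat -> C) : C :=
  limn (series (fun k => f k * conjc (g k))).

Definition basisvec (s : nat) : nat -> C := fun k => if k == s then 1 else 0.

Definition opgraph := (nat -> C) -> (nat -> C) -> Prop.

Definition dom (A : opgraph) (g : nat -> C) : Prop := exists h, A g h.

Definition adjoint (A : opgraph) : opgraph := fun g h =>
  l2 g /\ l2 h /\ forall f y, A f y -> ip y g = ip f h.

Definition closure_op (A : opgraph) : opgraph := fun g h =>
  l2 g /\ l2 h /\
  exists F Y : nat -> nat -> C,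
    (forall n, A (F n) (Y n)) /\
    (fun n => l2norm (fun k => F n k - g k)) @ \oo --> (0 : R) /\
    (fun n => l2norm (fun k => Y n k - h k)) @ \oo --> (0 : R).

Definition closable (A : opgraph) : Prop :=
  forall g h1 h2, closure_op A g h1 -> closure_op A g h2 -> h1 = h2.

Definition gbinom (x : R) (m : nat) : R :=
  (\prod_(i < m) (x - i%:R)) / (m`!)%:R.

Definition laguerre (b : R) (n : nat) : {poly C} :=
  \sum_(k < n.+1)
     ((((-1) ^+ k) / (k`!)%:R * gbinom (n%:R + b) (n - k))%:C)%C *: 'X^k.

(* r_k^b = sqrt( Gamma(k+b+1) / (k! Gamma(b+1)) ),
   using Gamma(k+b+1)/Gamma(b+1) = (b+1)(b+2)...(b+k). *)
Definition rnorm (b : R) (k : nat) : R :=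
  Num.sqrt ((\prod_(j < k) (b + j.+1%:R)) / (k`!)%:R).

Definition qt (a : R) (k : nat) : {poly C} :=
  (((rnorm a k)^-1)%:C)%C *: laguerre a k.

Definition represents (a : R) (c : nat -> C) (p : {poly C}) : Prop :=
  exists N, (forall k, (N <= k)%N -> c k = 0) /\ p = \sum_(k < N) c k *: qt a k.

(* a linear map on P_c (given by its graph), regarded as an operator
   in H(q~) with domain P_c *)
Definition op_in_H (a : R) (M : {poly C} -> {poly C} -> Prop) : opgraph :=
  fun f y => exists p q, M p q /\ represents a f p /\ represents a y q.

(* graph of E_{p,d} for p = L^(b) : E(L_n^(b)) = d_n L_n^(b), extended linearly *)
Definition E_laguerre (b : R) (d : nat -> C) (p q : {poly C}) : Prop :=
  exists N (c : nat -> C),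
    p = \sum_(n < N) c n *: laguerre b n /\
    q = \sum_(n < N) (d n * c n) *: laguerre b n.

Definition m_op (a : R) (p : {poly C}) : {poly C} :=
  2%:R *: ('X * p^`(2)) + 2%:R *: ((((a + 2%:R)%:C)%C%:P - 'X) * p^`()) + p.

Definition Dtilde (d : nat -> C) : Prop :=
  (forall n, d n != 0) /\ exists m n, d m != d n.

Definition dprev (d : nat -> C) (k : nat) : C :=
  if k is k'.+1 then d k' else 0.

Local Notation r a k := (((rnorm a k)%:C)%C).

Definition adj_coef (a : R) (d : nat -> C) (g : nat -> C) (k : nat) : C :=
  conjc (d k) * g k +
  \sum_(t < k) (conjc (d k) - conjc (dprev d k)) * (r a t * g t / r a k).

Definition clos_coef (a : R) (d : nat -> C) (g : nat -> C) (s : nat) : C :=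
  g s * d s +
  limn (series (fun j => let k := (s + j.+1)%N in
                          (d k - d k.-1) * (r a s / r a k) * g k : C)).

Definition m_coef (a : R) (g : nat -> C) (s : nat) : C :=
  g s * (- 2%:R * s%:R + 1) +
  limn (series (fun j => let k := (s + j.+1)%N in
                          (- 2%:R) * (r a s / r a k) * g k : C)).

End LaguerreDefs.

(* Main.v *)
(** Since [L_n^(a+1) = sum_(k <= n) L_k^(a)], the operator [T] acts on coordinates as
    follows: writing a finite sequence [f] as [f_k = r_k sum_(n >= k) c_n], its image
    is [y_k = r_k sum_(n >= k) d_n c_n]. Hence [h = T^* g] means that
    [sum_(k <= n) r_k h_k] equals [conj d_n sum_(k <= n) r_k g_k] for all [n], which
    gives (i)-(iii). If [((d_k - d_(k-1)) / r_k)] is in [l_2], Cauchy-Schwarz shows that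
    each coordinate of the formal matrix action is continuous on [l_2], so the closure
    is contained in the maximal matrix operator. Conversely let [g] and its formal image
    [h] be in [l_2]. Then [h_s / r_s - h_(s+1) / r_(s+1) = d_s (g_s / r_s - g_(s+1) / r_(s+1))],
    so truncating the [L^(a+1)]-expansion of [g] at [N] truncates that of [h], and the
    squared errors are [N |g_N|^2 / (a + 1)] and [N |h_N|^2 / (a + 1)] plus tails,
    because [sum_(k < N) r_k^2 = N r_N^2 / (a + 1)]. As the harmonic series diverges,
    both errors tend to [0] along a subsequence. For (v), the Laguerre equation makes [m^(a+1)]
    the case [d_n = 1 - 2 n], and [sum_k r_k^-2] telescopes when [a > 1]. *)

Require Import Defs.
From HB Require Import structures.
From mathcomp Require Import all_boot all_order all_algebra.
From mathcomp Require Import all_classical all_reals all_analysis.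
From mathcomp Require Import complex ring lra.
Set Implicit Arguments. Unset Strict Implicit. Unset Printing Implicit Defensive.
Import Order.TTheory GRing.Theory Num.Theory.
Import numFieldNormedType.Exports.
Local Open Scope classical_set_scope.
Local Open Scope ring_scope.

(** * Laguerre polynomials *)

(** Constant coefficient of the Laguerre equation, where all terms carrying a factor $x$ vanish;
    [y0] and [y1] are the coefficients of $1$ and $x$. The abstract ring keeps the complex numbers
    out of the computation. *)
Lemma laguerre_ode_coef0 (K : comNzRingType) (A y1 y0 n : K) :
  (A + 1 + 1) * y1 = - n * y0 ->
  2%:R * ((A + (1 + 1)) * y1) + y0 = (- 2%:R * n + 1) * y0.
Proof.
move=> h; apply/eqP; rewrite -subr_eq0; apply/eqP.
transitivity (2%:R * ((A + 1 + 1) * y1 - - n * y0)); first by ring.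
by rewrite h subrr mulr0.
Qed.

(** The same comparison at $x^{k_1}$ with $k_1>0$; it is used with $k_2=k_1+1$. *)
Lemma laguerre_ode_coef (K : comNzRingType) (A y1 y0 n : K) (k1 k2 : nat) :
  k2%:R * (k1%:R + (A + 1) + 1) * y1 = (k1%:R - n) * y0 ->
  2%:R * (y1 *+ k2 *+ k1) + 2%:R * ((A + (1 + 1)) * (y1 *+ k2) - y0 *+ k1) + y0 =
  (- 2%:R * n + 1) * y0.
Proof.
rewrite -[y1 *+ k2 *+ k1]mulr_natr -[y1 *+ k2]mulr_natr -[y0 *+ k1]mulr_natr.
move: (k1%:R : K) (k2%:R : K) => {}k1 {}k2 h; apply/eqP; rewrite -subr_eq0; apply/eqP.
transitivity (2%:R * (k2 * (k1 + (A + 1) + 1) * y1 - (k1 - n) * y0)); first by ring.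
by rewrite h subrr mulr0.
Qed.

Section Laguerre.
Context {R : realType}.
Local Notation C := (Cx R).
Implicit Types (a b x : R) (n k m : nat).

Lemma real_complexM (x y : R) : ((x * y)%:C)%C = (x%:C)%C * (y%:C)%C :> C.
Proof. exact: (rmorphM (real_complex R)). Qed.

Lemma real_complexD (x y : R) : ((x + y)%:C)%C = (x%:C)%C + (y%:C)%C :> C.
Proof. exact: (rmorphD (real_complex R)). Qed.

Lemma real_complexN (x : R) : ((- x)%:C)%C = - (x%:C)%C :> C.
Proof. exact: (rmorphN (real_complex R)). Qed.

Lemma real_complex_nat n : ((n%:R : R)%:C)%C = n%:R :> C.
Proof. exact: (rmorph_nat (real_complex R)). Qed.

Lemma real_complex1 : ((1 : R)%:C)%C = 1 :> C.
Proof. by []. Qed.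

Lemma gbinom0 x : gbinom x 0 = 1.
Proof. by rewrite /gbinom big_ord0 fact0 divr1. Qed.

Lemma gbinom_recr x m : m.+1%:R * gbinom x m.+1 = (x - m%:R) * gbinom x m.
Proof.
rewrite /gbinom big_ord_recr /= factS natrM.
have h1 : m.+1%:R != 0 :> R by rewrite pnatr_eq0.
have h2 : (m`!)%:R != 0 :> R by rewrite pnatr_eq0 -lt0n fact_gt0.
by field; rewrite h2 /= nat1r h1.
Qed.

Lemma gbinomS x m : gbinom (x + 1) m.+1 = gbinom x m + gbinom x m.+1.
Proof.
rewrite /gbinom big_ord_recl /= [in X in _ = _ + X]big_ord_recr /= factS natrM.
have h1 : m.+1%:R != 0 :> R by rewrite pnatr_eq0.
have h2 : (m`!)%:R != 0 :> R by rewrite pnatr_eq0 -lt0n fact_gt0.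
have -> : \prod_(i < m) (x + 1 - (bump 0 i)%:R) = \prod_(i < m) (x - i%:R).
  by apply: eq_bigr => i _; rewrite /bump /= add1n -natr1; ring.
by field; rewrite h2 /= nat1r h1.
Qed.

Lemma coef_laguerre b n k : (laguerre b n)`_k =
  if (k <= n)%N
  then (((-1) ^+ k / (k`!)%:R * gbinom (n%:R + b) (n - k))%:C)%C : C else 0.
Proof.
rewrite /laguerre coef_sum; case: leqP => kn.
  rewrite (bigD1 (Ordinal (kn : (k < n.+1)%N))) //= big1 ?addr0.
    by rewrite coefZ coefXn eqxx mulr1.
  move=> i ni; rewrite coefZ coefXn; case: eqP => [ki|]; last by rewrite mulr0.
  by move: ni; rewrite -val_eqE /= ki eqxx.
apply: big1 => i _; rewrite coefZ coefXn; case: eqP => [ki|]; last by rewrite mulr0.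
by have := ltn_ord i; rewrite -ki ltnS leqNgt kn.
Qed.

Lemma laguerre0 b : laguerre b 0 = 1 :> {poly C}.
Proof.
apply/polyP => k; rewrite coef_laguerre coef1 leqn0; case: k => [|k] //=.
by rewrite expr0 fact0 divr1 mul1r subn0 gbinom0.
Qed.

(** Coefficientwise this is the Pascal rule [gbinomS] with upper argument $n+1+b$. *)
Lemma laguerreS b n :
  laguerre (b + 1) n.+1 = laguerre (b + 1) n + laguerre b n.+1 :> {poly C}.
Proof.
apply/polyP => k; rewrite coefD !coef_laguerre; case: (ltngtP k n.+1) => kn.
- rewrite ltnS in kn; rewrite kn -rmorphD; congr (_%:C)%C.
  rewrite -mulrDr subSn //; congr (_ * _).
  have -> : n.+1%:R + (b + 1) = (n.+1%:R + b) + 1 by ring.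
  by rewrite gbinomS -natr1; congr (gbinom _ _ + _); ring.
- by rewrite leqNgt (ltn_trans _ kn) //= addr0.
- by rewrite kn ltnn add0r !subnn !gbinom0.
Qed.

Lemma laguerre_sum b n :
  laguerre (b + 1) n = \sum_(k < n.+1) laguerre b k :> {poly C}.
Proof.
elim: n => [|n IH]; first by rewrite big_ord1 !laguerre0.
by rewrite laguerreS big_ord_recr /= IH.
Qed.

(** The leading coefficient of $L_N^{(b)}$ is $(-1)^N/N!$, so the coefficients [c] can be peeled off
    from the top degree downwards. *)
Lemma laguerre_free b (N : nat) (c : nat -> C) :
  \sum_(k < N) c k *: laguerre b k = 0 -> forall k, (k < N)%N -> c k = 0.
Proof.
elim: N => [//|N IH] /[dup] /polyP /(_ N).
rewrite coef0 coef_sum big_ord_recr /= big1 => [|i _]; last first.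
  by rewrite coefZ coef_laguerre leqNgt ltn_ord mulr0.
rewrite add0r coefZ coef_laguerre leqnn subnn gbinom0 mulr1 => /eqP.
rewrite mulf_eq0 => /orP[/eqP cN|]; last first.
  rewrite (inj_eq (@complexI _) _ 0) mulf_eq0 signr_eq0 invr_eq0 pnatr_eq0.
  by rewrite eqn0Ngt fact_gt0.
rewrite big_ord_recr /= cN scale0r addr0 => /IH{}IH k.
by rewrite ltnS leq_eqVlt => /predU1P[->|/IH].
Qed.

(** This is the coefficient of $x^k$ in $xy''+(b+1-x)y'+ny=0$. *)
Lemma coef_laguerre_rec b n k :
  ((k.+1%:R * (k%:R + b + 1))%:C)%C * (laguerre b n)`_k.+1 =
  ((k%:R - n%:R)%:C)%C * (laguerre b n)`_k :> C.
Proof.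
rewrite !coef_laguerre; case: (ltngtP k n) => kn.
- rewrite -!rmorphM; congr (_%:C)%C.
  have -> : (n - k = (n - k.+1).+1)%N by rewrite subnSK.
  have := gbinom_recr (n%:R + b) (n - k.+1).
  have -> : ((n - k.+1).+1)%:R = n%:R - k%:R :> R.
    by rewrite subnSK // natrB // ltnW.
  rewrite natrB // -[k.+1%:R]natr1 exprS factS natrM -[k.+1%:R]natr1.
  set G := gbinom _ _; set G' := gbinom _ _ => h.
  have h1 : k%:R + 1 != 0 :> R by rewrite natr1 pnatr_eq0.
  have h2 : (k`!)%:R != 0 :> R by rewrite pnatr_eq0 -lt0n fact_gt0.
  have {}h : (n%:R - k%:R) * G = (k%:R + b + 1) * G' by rewrite h; ring.
  transitivity (- (-1) ^+ k / k`!%:R * ((k%:R + b + 1) * G')).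
    by field; rewrite h2.
  by rewrite -h; field; rewrite h2.
- by rewrite !mulr0.
- by rewrite kn subrr mulr0 mul0r.
Qed.

Lemma m_op_laguerre a n :
  m_op a (laguerre (a + 1) n) =
  (- 2%:R * n%:R + 1) *: laguerre (a + 1) n :> {poly C}.
Proof.
apply/polyP => k; rewrite /m_op !(coefD, coefZ) mulrBl coefB coefCM.
rewrite !coefXM !coef_deriv.
have := coef_laguerre_rec (a + 1) n k.
rewrite !real_complexM !real_complexD !real_complexN !real_complex_nat real_complex1.
set L := laguerre _ _; set A : C := (a%:C)%C.
case: k => [|k] /=.
  rewrite mulr1n mulr0 subr0 !add0r mul1r => h.
  exact: laguerre_ode_coef0 h.
exact: laguerre_ode_coef.
Qed.

End Laguerre.

(** * The operators in coordinates *)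

(** Exchange of summation over $k\le n<N$. A general module is taken because the identity serves
    both for polynomials and for inner products with values in [C]. *)
Lemma sum_scale_partial_sums (K : pzRingType) (V : lmodType K) (c : nat -> K)
    (L : nat -> V) (N : nat) :
  \sum_(n < N) c n *: (\sum_(k < n.+1) L k) =
  \sum_(k < N) (\sum_(k <= n < N) c n) *: L k.
Proof.
elim: N => [|N IH]; first by rewrite !big_ord0.
rewrite big_ord_recr /= IH scaler_sumr.
have -> : \sum_(k < N) (\sum_(k <= n < N) c n) *: L k =
    \sum_(k < N.+1) (\sum_(k <= n < N) c n) *: L k.
  by rewrite [RHS]big_ord_recr /= [in RHS]big_geq // scale0r addr0.
rewrite -big_split /=; apply: eq_bigr => k _.
by rewrite [in RHS]big_nat_recr ?scalerDl // -ltnS.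
Qed.

Section Coordinates.
Context {R : realType}.
Local Notation C := (Cx R).
Variable a : R.
Hypothesis a_gtN1 : -1 < a.
Implicit Types (n k m N : nat) (f g h y c d : nat -> C) (p q : {poly C}).
Local Notation r k := (((rnorm a k)%:C)%C : C).

Lemma rnorm_arg_gt0 k : 0 < (\prod_(j < k) (a + j.+1%:R)) / (k`!)%:R.
Proof.
apply: divr_gt0; last by rewrite ltr0n fact_gt0.
apply: prodr_gt0 => j _; rewrite -natr1.
have : 0 <= j%:R :> R by [].
by move: a_gtN1; lra.
Qed.

Lemma rnorm_gt0 k : 0 < rnorm a k.
Proof. by rewrite sqrtr_gt0 rnorm_arg_gt0. Qed.

Lemma rnormC_neq0 k : r k != 0.
Proof. by rewrite (inj_eq (@complexI _) _ 0) gt_eqF // rnorm_gt0. Qed.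

Lemma rnorm_sqS k :
  k.+1%:R * rnorm a k.+1 ^+ 2 = (a + k.+1%:R) * rnorm a k ^+ 2.
Proof.
rewrite !sqr_sqrtr ?ltW ?rnorm_arg_gt0 // big_ord_recr /= factS natrM.
have h1 : k.+1%:R != 0 :> R by rewrite pnatr_eq0.
have h2 : (k`!)%:R != 0 :> R by rewrite pnatr_eq0 -lt0n fact_gt0.
by field; rewrite h2 /= nat1r h1.
Qed.

(** As [rnorm a k ^+ 2] is $\binom{k+a}{k}$, this is a hockey-stick identity. *)
Lemma sum_rnorm_sq N :
  \sum_(0 <= k < N) rnorm a k ^+ 2 = N%:R / (a + 1) * rnorm a N ^+ 2.
Proof.
have a1 : a + 1 != 0 by rewrite gt_eqF //; move: a_gtN1; lra.
elim: N => [|N IH]; first by rewrite big_nil !mul0r.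
rewrite big_nat_recr //= IH [RHS]mulrAC rnorm_sqS -[N.+1%:R]natr1.
by field.
Qed.

Lemma sum_laguerreD1 N c :
  \sum_(n < N) c n *: laguerre (a + 1) n =
  \sum_(k < N) (\sum_(k <= n < N) c n) *: laguerre a k.
Proof.
by rewrite -sum_scale_partial_sums; apply: eq_bigr => n _; rewrite laguerre_sum.
Qed.

Lemma scale_qt (z : C) k : (z * r k) *: qt a k = z *: laguerre a k.
Proof.
rewrite /qt scalerA -mulrA.
have -> : (((rnorm a k)^-1)%:C)%C = (r k)^-1 by exact: (fmorphV (real_complex R)).
by rewrite divff ?mulr1 // rnormC_neq0.
Qed.

Lemma sum_qt_widen f N M : (N <= M)%N -> (forall k, (N <= k)%N -> f k = 0) ->
  \sum_(k < N) f k *: qt a k = \sum_(k < M) f k *: qt a k.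
Proof.
move=> NM f0; rewrite -!(big_mkord xpredT (fun k => f k *: qt a k)).
rewrite [RHS](big_cat_nat (leq0n N) NM) /= [X in _ = _ + X]big_nat_cond.
rewrite [X in _ = _ + X]big1 ?addr0 // => k /andP[/andP[/f0 -> _] _].
by rewrite scale0r.
Qed.

Lemma represents_inj f g p : represents a f p -> represents a g p -> f = g.
Proof.
move=> [N [f0 pf]] [M [g0 pg]]; apply/funext => k.
(* A common length for both expansions that also covers the index [k] under study. *)
pose L := maxn k.+1 (maxn N M).
have : \sum_(k < L) (f k / r k - g k / r k) *: laguerre a k = 0.
  rewrite (eq_bigr (fun k : 'I_L => f k *: qt a k - g k *: qt a k)); last first.
    move=> i _; rewrite scalerBl -!scale_qt.
    by rewrite !divfK ?rnormC_neq0.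
  rewrite sumrB -(sum_qt_widen _ f0) ?leq_max ?leqnn ?orbT //.
  by rewrite -(sum_qt_widen _ g0) ?leq_max ?leqnn ?orbT // -pf -pg subrr.
move/(laguerre_free (c := fun k => f k / r k - g k / r k))/(_ k).
rewrite leq_max leqnn => /(_ isT)/eqP; rewrite -mulrBl mulf_eq0 invr_eq0.
by rewrite (negPf (rnormC_neq0 k)) orbF subr_eq0 => /eqP.
Qed.

Lemma represents_laguerreD1 N c :
  represents a (fun k => (\sum_(k <= n < N) c n) * r k)
    (\sum_(n < N) c n *: laguerre (a + 1) n).
Proof.
exists N; split=> [k Nk|]; first by rewrite big_geq // mul0r.
by rewrite sum_laguerreD1; apply: eq_bigr => k _; rewrite scale_qt.
Qed.

(** The adjoint and the closure are computed from this description alone, without polynomials. *)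
Lemma op_in_H_E_laguerreP d f y :
  op_in_H a (E_laguerre (a + 1) d) f y <->
  exists N c, f = (fun k => (\sum_(k <= n < N) c n) * r k) /\
              y = (fun k => (\sum_(k <= n < N) d n * c n) * r k).
Proof.
split=> [[p [q [[N [c [-> ->]]] [fp yq]]]]|[N [c [-> ->]]]].
  exists N, c; split; first exact: represents_inj fp (represents_laguerreD1 N c).
  exact: represents_inj yq (represents_laguerreD1 N (fun n => d n * c n)).
exists (\sum_(n < N) c n *: laguerre (a + 1) n).
exists (\sum_(n < N) (d n * c n) *: laguerre (a + 1) n).
split; first by exists N, c.
by split; [exact: represents_laguerreD1|exact: (represents_laguerreD1 N (fun n => d n * c n))].
Qed.

Lemma sum_telescope_down N k (u : nat -> C) : (k <= N)%N ->
  \sum_(k <= n < N) (u n - u n.+1) = u k - u N.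
Proof.
move=> kN; rewrite -[RHS]opprB -telescope_sumr // -sumrN.
by apply: eq_bigr => n _; rewrite opprB.
Qed.

Lemma m_opP (z : C) p q : m_op a (p + z *: q) = m_op a p + z *: m_op a q.
Proof.
rewrite /m_op derivnD derivnZ derivD derivZ !mulrDr -!scalerAr !scalerDr.
rewrite ![z *: (2%:R *: _)]scalerA ![2%:R *: (z *: _)]scalerA ![z * _]mulrC.
by rewrite -!addrA; congr (_ + _); rewrite [LHS]addrCA; congr (_ + _);
  rewrite ![_ + (p + _)]addrCA; congr (_ + _); rewrite addrA [in RHS]addrA.
Qed.

Lemma m_op_sum N c : m_op a (\sum_(n < N) c n *: laguerre (a + 1) n) =
  \sum_(n < N) ((- 2%:R * n%:R + 1) * c n) *: laguerre (a + 1) n.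
Proof.
elim: N => [|N IH].
  by rewrite !big_ord0 /m_op linear0 deriv0 !mulr0 !scaler0 !addr0.
rewrite !big_ord_recr /= m_opP IH m_op_laguerre scalerA.
by rewrite [c N * _]mulrC.
Qed.

(** Since [m_op] accepts every polynomial, each one has to be expanded in the $L_n^{(a+1)}$ before
    the eigenvalue relation applies. *)
Lemma op_in_H_m_op f y :
  op_in_H a (fun p q => q = m_op a p) f y <->
  op_in_H a (E_laguerre (a + 1) (fun n => - 2%:R * n%:R + 1)) f y.
Proof.
split=> [[p [q [-> [fp yq]]]]|[p [q [[N [c [-> ->]]] [fp yq]]]]]; last first.
  exists (\sum_(n < N) c n *: laguerre (a + 1) n).
  exists (\sum_(n < N) ((- 2%:R * n%:R + 1) * c n) *: laguerre (a + 1) n).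
  by rewrite m_op_sum.
exists p, (m_op a p); split=> //; case: fp => N [f0 ->].
(* Inverse of the partial summation: [u N = 0], so the tail sums of the differences give back
   [u]. *)
pose u k := f k / r k; exists N, (fun n => u n - u n.+1).
suff <- : \sum_(n < N) (u n - u n.+1) *: laguerre (a + 1) n =
  \sum_(k < N) f k *: qt a k by rewrite (m_op_sum N (fun n => u n - u n.+1)).
rewrite (sum_laguerreD1 N (fun n => u n - u n.+1)); apply: eq_bigr => k _.
rewrite sum_telescope_down /u; last exact: ltnW.
by rewrite (f0 N) // mul0r subr0 -scale_qt divfK // rnormC_neq0.
Qed.

End Coordinates.

(** * Complex square-summable sequences *)

Section SquareSummable.
Context {R : realType}.
Local Notation C := (Cx R).
Implicit Types (u v w : nat -> C) (z x y : C) (n k m N : nat).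

Lemma conjCM x y : conjc (x * y) = conjc x * conjc y :> C.
Proof. exact: (rmorphM (@conjc R)). Qed.

Lemma conjCB x y : conjc (x - y) = conjc x - conjc y :> C.
Proof. exact: (rmorphB (@conjc R)). Qed.

Lemma conjC_real (t : R) : conjc ((t%:C)%C) = (t%:C)%C :> C.
Proof. exact: conjc_real. Qed.

Lemma conjC_sum n u : conjc (\sum_(k < n) u k) = \sum_(k < n) conjc (u k) :> C.
Proof. exact: (rmorph_sum (@conjc R)). Qed.

Definition l2sq u : R := limn (series (fun k => sqnorm (u k))).

Lemma sqnorm_ge0 z : 0 <= sqnorm z.
Proof. by rewrite addr_ge0 // sqr_ge0. Qed.
Hint Resolve sqnorm_ge0 : core.

Lemma sqnorm0 : sqnorm (0 : C) = 0.
Proof. by rewrite /sqnorm /= expr0n /= addr0. Qed.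

Lemma sqnorm_eq0 z : sqnorm z = 0 -> z = 0.
Proof.
case: z => x y /eqP; rewrite paddr_eq0 ?sqr_ge0 //= !sqrf_eq0.
by move=> /andP[/eqP-> /eqP->].
Qed.

Lemma sqnormN z : sqnorm (- z) = sqnorm z.
Proof. by case: z => x y; rewrite /sqnorm /= !sqrrN. Qed.

Lemma sqnormM x y : sqnorm (x * y) = sqnorm x * sqnorm y.
Proof. by case: x y => [x1 x2] [y1 y2]; rewrite /sqnorm /=; ring. Qed.

Lemma sqnorm_conj z : sqnorm (conjc z : C) = sqnorm z.
Proof. by case: z => x y; rewrite /sqnorm /= sqrrN. Qed.

Lemma sqnorm_real (t : R) : sqnorm ((t%:C)%C : C) = t ^+ 2.
Proof. by rewrite /sqnorm /= expr0n addr0. Qed.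

Lemma sqnormD x y :
  sqnorm (x + y) = sqnorm x + sqnorm y + 2%:R * complex.Re (x * conjc y).
Proof. by case: x y => [x1 x2] [y1 y2]; rewrite /sqnorm /=; ring. Qed.

Lemma sqnormD_le x y : sqnorm (x + y) <= 2%:R * (sqnorm x + sqnorm y).
Proof.
case: x y => [x1 x2] [y1 y2]; rewrite /sqnorm /= -subr_ge0.
have -> : 2%:R * (x1 ^+ 2 + x2 ^+ 2 + (y1 ^+ 2 + y2 ^+ 2)) -
  ((x1 + y1) ^+ 2 + (x2 + y2) ^+ 2) = (x1 - y1) ^+ 2 + (x2 - y2) ^+ 2 by ring.
by rewrite addr_ge0 // sqr_ge0.
Qed.

Lemma sqnormB_le x y : sqnorm (x - y) <= 2%:R * (sqnorm x + sqnorm y).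
Proof. by rewrite -(sqnormN y) sqnormD_le. Qed.

Lemma Re_le_norm z : `|complex.Re z| <= Num.sqrt (sqnorm z).
Proof. by rewrite -sqrtr_sqr ler_sqrt ?addr_ge0 ?sqr_ge0 // lerDl sqr_ge0. Qed.

Lemma Im_le_norm z : `|complex.Im z| <= Num.sqrt (sqnorm z).
Proof. by rewrite -sqrtr_sqr ler_sqrt ?addr_ge0 ?sqr_ge0 // lerDr sqr_ge0. Qed.

Lemma norm_le_ReIm z : Num.sqrt (sqnorm z) <= `|complex.Re z| + `|complex.Im z|.
Proof.
have h : 0 <= `|complex.Re z| + `|complex.Im z| by rewrite addr_ge0.
rewrite -[leRHS]ger0_norm // -[leRHS]sqrtr_sqr ler_sqrt ?sqr_ge0 //.
rewrite sqrrD !real_normK ?num_real // /sqnorm addrAC lerDl.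
by rewrite mulrn_wge0 // mulr_ge0.
Qed.

(** Follows from $|\Re z|,|\Im z|\le|z|\le|\Re z|+|\Im z|$. It gives access to the order-based
    convergence criteria of the reals. *)
Lemma cvgn_complexP u x : u @ \oo --> x <->
  (fun n => complex.Re (u n)) @ \oo --> complex.Re x /\
  (fun n => complex.Im (u n)) @ \oo --> complex.Im x.
Proof.
have ReB y z : complex.Re (y - z) = complex.Re y - complex.Re z by case: y z => ? ? [].
have ImB y z : complex.Im (y - z) = complex.Im y - complex.Im z by case: y z => ? ? [].
split=> [/cvgrPdist_lt ux|[/cvgrPdist_lt ur /cvgrPdist_lt ui]].
  split; apply/cvgrPdist_lt => e e0; have := ux ((e%:C)%C : C);
    rewrite ltcR => /(_ e0); apply: filterS => n;
    rewrite normc_def ltcR; apply: le_lt_trans.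
    by rewrite -ReB Re_le_norm.
  by rewrite -ImB Im_le_norm.
apply/cvgrPdist_lt => e e0.
(* The radius [e] lives in [C], but a positive complex number is real. *)
have [t et] : exists t : R, e = (t%:C)%C by apply/complex_realP; exact: gtr0_real.
have t0 : 0 < t / 2 by move: e0; rewrite et (ltcR 0) => t0; rewrite divr_gt0.
have := ui _ t0; have := ur _ t0; apply: filterS2 => n h1 h2.
rewrite normc_def et ltcR; apply: le_lt_trans (norm_le_ReIm _) _.
by rewrite ReB ImB [t]splitr ltrD.
Qed.

Lemma Re_series u n : complex.Re (series u n) = series (fun k => complex.Re (u k)) n.
Proof.
rewrite !seriesEnat /=; elim: n => [|n IH]; first by rewrite !big_nil.
by rewrite !big_nat_recr //= -IH; case: (\sum_(_ <= _ < _) _) (u n) => ? ? [].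
Qed.

Lemma Im_series u n : complex.Im (series u n) = series (fun k => complex.Im (u k)) n.
Proof.
rewrite !seriesEnat /=; elim: n => [|n IH]; first by rewrite !big_nil.
by rewrite !big_nat_recr //= -IH; case: (\sum_(_ <= _ < _) _) (u n) => ? ? [].
Qed.

Lemma series_sqnorm_homo u :
  {homo series (fun k => sqnorm (u k)) : n m / (n <= m)%N >-> n <= m}.
Proof. by rewrite seriesEnat; apply: nondecreasing_series. Qed.

Lemma l2P u : l2 u <-> exists B, forall n, series (fun k => sqnorm (u k)) n <= B.
Proof.
split=> [lu|[B uB]].
  by exists (l2sq u) => n; apply: nondecreasing_cvgn_le => //; exact: series_sqnorm_homo.
apply: nondecreasing_is_cvgn; first exact: series_sqnorm_homo.
by exists B => _ [n _ <-].
Qed.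

Lemma series_le_l2sq u n : l2 u -> series (fun k => sqnorm (u k)) n <= l2sq u.
Proof. by move=> lu; apply: nondecreasing_cvgn_le => //; exact: series_sqnorm_homo. Qed.

Lemma l2sq_le u B : l2 u -> (forall n, series (fun k => sqnorm (u k)) n <= B) ->
  l2sq u <= B.
Proof. by move=> lu uB; apply: limr_le => //; exact: nearW. Qed.

Lemma l2sq_ge0 u : l2 u -> 0 <= l2sq u.
Proof. by move=> lu; have := series_le_l2sq 0 lu; rewrite seriesEnat /= big_nil. Qed.

Lemma l2normE u : l2norm u = Num.sqrt (l2sq u).
Proof. by []. Qed.

Lemma sqnorm_le_l2sq u k : l2 u -> sqnorm (u k) <= l2sq u.
Proof.
move=> lu; apply: le_trans (series_le_l2sq k.+1 lu).
by rewrite seriesEnat /= big_nat_recr //= lerDr sumr_ge0.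
Qed.

Lemma l2_le (K : R) u v : l2 v -> (forall k, sqnorm (u k) <= K * sqnorm (v k)) -> l2 u.
Proof.
move=> lv uv; apply/l2P; exists (`|K| * l2sq v) => n.
apply: le_trans (ler_wpM2l (normr_ge0 K) (series_le_l2sq n lv)).
rewrite !seriesEnat /= mulr_sumr ler_sum // => k _.
by apply: le_trans (uv k) _; rewrite ler_wpM2r // ler_norm.
Qed.

Lemma l2B u v : l2 u -> l2 v -> l2 (fun k => u k - v k).
Proof.
move=> lu lv; apply/l2P; exists (2%:R * (l2sq u + l2sq v)) => n.
apply: le_trans (ler_wpM2l _ (lerD (series_le_l2sq n lu) (series_le_l2sq n lv))); last by [].
rewrite !seriesEnat /= -big_split /= mulr_sumr ler_sum // => k _.
exact: sqnormB_le.
Qed.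

(** The shift [s + j.+1] starts strictly after [s], as the tails in [clos_coef] do. *)
Lemma series_shift_le (t : nat -> R) s n : (forall k, 0 <= t k) ->
  series (fun j => t (s + j.+1)%N) n <= series t (s + n).+1.
Proof.
move=> t0; rewrite !seriesEnat /=; elim: n => [|n IH].
  by rewrite big_nil sumr_ge0.
by rewrite big_nat_recr //= addnS [leRHS]big_nat_recr //= lerD.
Qed.

Lemma l2_shift u s : l2 u -> l2 (fun j => u (s + j.+1)%N).
Proof.
move=> lu; apply/l2P; exists (l2sq u) => n.
apply: le_trans (series_le_l2sq (s + n).+1 lu).
exact: (series_shift_le (t := fun k => sqnorm (u k))).
Qed.

Lemma l2sq_shift_le u s : l2 u -> l2sq (fun j => u (s + j.+1)%N) <= l2sq u.
Proof.
move=> lu; apply: l2sq_le; first exact: l2_shift.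
move=> n; apply: le_trans (series_le_l2sq (s + n).+1 lu).
exact: (series_shift_le (t := fun k => sqnorm (u k))).
Qed.

Lemma l2_eventually u v N : (forall k, (N <= k)%N -> u k = v k) -> l2 u -> l2 v.
Proof.
move=> uv lu; apply/l2P.
exists (series (fun k => sqnorm (v k)) N + l2sq u) => n.
case: (leqP n N) => [nN|/ltnW Nn].
  by rewrite -[leLHS]addr0 lerD ?l2sq_ge0 // series_sqnorm_homo.
rewrite -lerBlDl sub_series_geq //; apply: le_trans (series_le_l2sq n lu).
rewrite -[leRHS]subr0 -[X in _ - X](_ : series (fun k => sqnorm (u k)) 0 = 0).
  rewrite sub_series_geq // [leRHS](big_cat_nat (leq0n N) Nn) /=.
  rewrite (eq_big_nat _ _ (F2 := fun k => sqnorm (u k))).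
    by rewrite lerDr sumr_ge0.
  by move=> k /andP[/uv ->].
by rewrite seriesEnat /= big_nil.
Qed.

Lemma l2_finite u N : (forall k, (N <= k)%N -> u k = 0) -> l2 u.
Proof.
move=> u0; apply: (@l2_eventually (fun=> 0) u N) => [k /u0 //|].
by apply/l2P; exists 0 => n; rewrite seriesEnat /= big1 // => k _; exact: sqnorm0.
Qed.

Lemma CauchySchwarz_series u v n :
  sqnorm (series (fun k => u k * v k) n) <=
  series (fun k => sqnorm (u k)) n * series (fun k => sqnorm (v k)) n.
Proof.
rewrite !seriesEnat /=; elim: n => [|n IH]; first by rewrite !big_nil sqnorm0 mul0r.
rewrite !big_nat_recr //=.
set S := \sum_(_ <= _ < _) _ in IH *; set A := \sum_(_ <= _ < _) _ in IH *.
set B := \sum_(_ <= _ < _) _ in IH *.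
have A0 : 0 <= A by rewrite sumr_ge0.
have B0 : 0 <= B by rewrite sumr_ge0.
have -> : sqnorm (S + u n * v n) = sqnorm S + sqnorm (u n) * sqnorm (v n) +
    2%:R * complex.Re (S * conjc (u n * v n)).
  by rewrite -sqnormM sqnormD.
have hx : complex.Re (S * conjc (u n * v n)) ^+ 2 <=
    (A * sqnorm (v n)) * (B * sqnorm (u n)).
  have : complex.Re (S * conjc (u n * v n)) ^+ 2 <= sqnorm (S * conjc (u n * v n)).
    by rewrite lerDl sqr_ge0.
  rewrite sqnormM sqnorm_conj sqnormM => /le_trans; apply.
  apply: le_trans (ler_wpM2r _ IH) _; first by rewrite mulr_ge0.
  by rewrite le_eqVlt; apply/orP; left; apply/eqP; ring.
(* Arithmetic-geometric mean: if $p+q<2x$ with $x^2\le pq$, then $(p+q)^2<4x^2\le4pq$, against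
   $(p-q)^2\ge0$. *)
have h2 : 2%:R * complex.Re (S * conjc (u n * v n)) <=
    A * sqnorm (v n) + B * sqnorm (u n).
  move: hx; set x := complex.Re _.
  have : 0 <= A * sqnorm (v n) by rewrite mulr_ge0.
  have : 0 <= B * sqnorm (u n) by rewrite mulr_ge0.
  move: (A * _) (B * _) => p q q0 p0 hx.
  rewrite leNgt; apply/negP => h.
  have : (p + q) ^+ 2 < (2%:R * x) ^+ 2.
    by rewrite ltr_pXn2r ?nnegrE ?addr_ge0 // ltW // (le_lt_trans _ h) ?addr_ge0.
  have : 0 <= (p - q) ^+ 2 by exact: sqr_ge0.
  by nra.
by move: IH h2; nra.
Qed.

(** The real and imaginary parts converge absolutely, being dominated by $|u_k|^2+|v_k|^2$. *)
Lemma is_cvg_seriesM u v : l2 u -> l2 v ->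
  cvgn (series (fun k => u k * v k) : nat -> C).
Proof.
move=> lu lv.
have abs (t : nat -> R) : (forall k, `|t k| <= sqnorm (u k) + sqnorm (v k)) ->
    cvgn (series t).
  move=> ht; apply: normed_cvg.
  apply: (series_le_cvg _ _ ht) => [k|k|] //; first by rewrite addr_ge0.
  exact: (is_cvg_seriesD lu lv).
have key (p q p' q' : R) : `|p * q - p' * q'| <= p ^+ 2 + p' ^+ 2 + (q ^+ 2 + q' ^+ 2).
  have := sqr_ge0 (p - q); have := sqr_ge0 (p' - q').
  have := sqr_ge0 (p + q); have := sqr_ge0 (p' + q').
  have := sqr_ge0 p; have := sqr_ge0 p'; have := sqr_ge0 q; have := sqr_ge0 q'.
  by move=> *; rewrite ler_norml; apply/andP; split; nra.
(* The imaginary part of a product is reduced to the shape of the real part by swapping [q] with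
   [q'] and negating [p']. *)
have key' (p q p' q' : R) : `|p * q' + p' * q| <= p ^+ 2 + p' ^+ 2 + (q ^+ 2 + q' ^+ 2).
  by have := key p q' (- p') q; rewrite mulNr opprK sqrrN [q ^+ 2 + _]addrC.
have keyR z z' : `|complex.Re (z * z')| <= sqnorm z + sqnorm z'.
  by case: z z' => [p p'] [q q']; exact: (key p q p' q').
have keyI z z' : `|complex.Im (z * z')| <= sqnorm z + sqnorm z'.
  by case: z z' => [p p'] [q q']; exact: (key' p q p' q').
have /cvg_ex[/= x hx] := abs (fun k => complex.Re (u k * v k)) (fun k => keyR _ _).
have /cvg_ex[/= y hy] := abs (fun k => complex.Im (u k * v k)) (fun k => keyI _ _).
apply: (cvgP ((x +i* y)%C : C)); apply/cvgn_complexP; split.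
  by under eq_fun do rewrite Re_series.
by under eq_fun do rewrite Im_series.
Qed.

Lemma CauchySchwarz_lim u v : l2 u -> l2 v ->
  sqnorm (limn (series (fun k => u k * v k) : nat -> C)) <= l2sq u * l2sq v.
Proof.
move=> lu lv; have /cvgn_complexP[hr hi] := is_cvg_seriesM lu lv.
have h := cvgD (cvgM hr hr) (cvgM hi hi).
rewrite {1}/sqnorm !expr2; apply: (cvgr_to_le (h _ _ _)); apply: nearW => n.
have := CauchySchwarz_series u v n; rewrite {1}/sqnorm !expr2 => /le_trans; apply.
by apply: ler_pM; rewrite ?series_le_l2sq // seriesEnat /= sumr_ge0.
Qed.

Lemma limn_eventually u N x : (forall n, (N <= n)%N -> u n = x) -> limn u = x.
Proof.
move=> ux; apply: cvg_lim; first exact: norm_hausdorff.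
by apply: cvg_near_cst; exists N.
Qed.

Lemma ip_finite u v N : (forall k, (N <= k)%N -> u k = 0) ->
  ip u v = \sum_(0 <= k < N) u k * conjc (v k).
Proof.
move=> u0; apply: (@limn_eventually _ N) => n Nn; rewrite seriesEnat /=.
rewrite (big_cat_nat (leq0n N) Nn) /= [X in _ + X]big_nat_cond [X in _ + X]big1 ?addr0 //.
by move=> k /andP[/andP[/u0 -> _] _]; rewrite mul0r.
Qed.

Lemma cvg0_l2norm (w : nat -> nat -> C) : (forall n, l2 (w n)) ->
  ((fun n => l2norm (w n)) @ \oo --> (0 : R)) <->
  ((fun n => l2sq (w n)) @ \oo --> (0 : R)).
Proof.
move=> lw; split=> h.
  have -> : (fun n => l2sq (w n)) = (fun n => l2norm (w n) * l2norm (w n)).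
    by apply/funext => n /=; rewrite l2normE -expr2 sqr_sqrtr // l2sq_ge0.
  by rewrite -[X in _ --> X](mulr0 0); exact: cvgM.
have := cvg_comp _ _ h (@sqrt_continuous R 0).
by rewrite sqrtr0.
Qed.

End SquareSummable.

(** * The adjoint *)

Section Adjoint.
Context {R : realType}.
Local Notation C := (Cx R).
Variables (a : R) (d : nat -> C).
Hypothesis a_gtN1 : -1 < a.
Implicit Types (n k m N : nat) (f g h y c : nat -> C).
Local Notation r k := (((rnorm a k)%:C)%C : C).
Local Notation T := (op_in_H a (E_laguerre (a + 1) d)).

(** Because $L_n^{(a+1)}=\sum_{k\le n}r_k\widetilde q_k$, the value [wsum g n.+1] is the inner
    product of $g$ with $L_n^{(a+1)}$. *)
Definition wsum g n : C := \sum_(k < n) r k * g k.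

Lemma wsumS g n : wsum g n.+1 = wsum g n + r n * g n.
Proof. by rewrite /wsum big_ord_recr. Qed.

Lemma wsum_inj g h : (forall n, wsum g n.+1 = wsum h n.+1) -> g = h.
Proof.
move=> gh; apply/funext => k; apply: (mulfI (rnormC_neq0 a_gtN1 k)).
have := gh k; rewrite !wsumS; case: k => [|k]; last by rewrite gh => /addrI.
by rewrite /wsum !big_ord0 !add0r.
Qed.

Lemma wsum_adj_coef g n : wsum (adj_coef a d g) n.+1 = conjc (d n) * wsum g n.+1.
Proof.
(* The weighted coefficients are differences of consecutive values, so their sum telescopes,
   starting from the empty sum at [k = 0]. *)
have adjE k : r k * adj_coef a d g k =
    conjc (d k) * wsum g k.+1 - conjc (dprev d k) * wsum g k.
  rewrite /adj_coef -mulr_sumr -mulr_suml -/(wsum g k) wsumS.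
  rewrite mulrDr !(mulrCA (r k)) divff ?rnormC_neq0 // mulr1 mulrBl mulrDr addrA.
  by congr (_ - _); rewrite addrC.
elim: n => [|n IH]; rewrite wsumS adjE.
  by rewrite [wsum (adj_coef _ _ _) 0]/wsum [wsum g 0]/wsum !big_ord0 mulr0 subr0 add0r.
by rewrite IH addrCA subrr addr0.
Qed.

Lemma ip_sum_tail N c g :
  ip (fun k => (\sum_(k <= n < N) c n) * r k) g =
  \sum_(n < N) c n * conjc (wsum g n.+1).
Proof.
rewrite (@ip_finite _ _ _ N); last by move=> k Nk; rewrite big_geq ?mul0r.
rewrite big_mkord.
(* Products are read as scalings in the regular module [C^o], so that the exchange of summation
   applies. *)
transitivity (\sum_(k < N) (\sum_(k <= n < N) c n) *: (r k * conjc (g k) : C^o)).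
  by apply: eq_bigr => k _; rewrite -mulrA.
rewrite -(sum_scale_partial_sums c (fun k => r k * conjc (g k) : C^o)).
apply: eq_bigr => n _; congr (_ * _).
rewrite /wsum (conjC_sum _ (fun k => r k * g k)); apply: eq_bigr => k _.
by rewrite conjCM conjC_real.
Qed.

(** The graph of [T] is spanned by the pairs $(L_n^{(a+1)},d_nL_n^{(a+1)})$; testing on these fixes
    every [wsum h n.+1], hence [h]. *)
Lemma adjointP g h : adjoint T g h <-> l2 g /\ l2 h /\ h = adj_coef a d g.
Proof.
split=> [[lg [lh gh]]|[lg [lh hE]]]; do 2 split=> //; last first.
  move=> f y /(op_in_H_E_laguerreP a_gtN1)[N [c [-> ->]]]; rewrite hE.
  rewrite (ip_sum_tail N (fun n => d n * c n)) ip_sum_tail; apply: eq_bigr => n _.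
  rewrite wsum_adj_coef conjCM conjcK.
  by rewrite mulrA [d n * c n]mulrC.
apply: wsum_inj => n; rewrite wsum_adj_coef.
(* This choice of coefficients is the test vector $L_n^{(a+1)}$. *)
pose c k : C := (k == n)%:R.
have pick (F : nat -> C) : \sum_(k < n.+1) c k * F k = F n.
  rewrite big_ord_recr /= /c eqxx mul1r big1 ?add0r // => k _.
  by rewrite ltn_eqF ?mul0r.
have /gh : T (fun k => (\sum_(k <= m < n.+1) c m) * r k)
             (fun k => (\sum_(k <= m < n.+1) d m * c m) * r k).
  by apply/(op_in_H_E_laguerreP a_gtN1); exists n.+1, c.
rewrite (ip_sum_tail n.+1 (fun n => d n * c n)) ip_sum_tail (pick (fun k => conjc (wsum h k.+1))).
rewrite (eq_bigr (fun k : 'I_n.+1 => c k * (d k * conjc (wsum g k.+1)))); last first.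
  by move=> k _; rewrite mulrA [d k * c k]mulrC.
rewrite (pick (fun k => d k * conjc (wsum g k.+1))) => /(congr1 (@conjc R)).
by rewrite conjcK conjCM conjcK.
Qed.

End Adjoint.

(** * The closure *)

(** Otherwise $t_N\ge e/N$ from $M$ on, and comparison with [t] would make the harmonic series
    converge. *)
Lemma liminf_natmul_summable (R : realType) (t : nat -> R) :
  (forall n, 0 <= t n) -> cvgn (series t) ->
  forall (e : R) (M : nat), 0 < e -> exists2 N, (M <= N)%N & N%:R * t N < e.
Proof.
move=> t0 ct e M e0; apply: contrapT => noN.
have big N : (M <= N)%N -> e <= N%:R * t N.
  by move=> MN; rewrite leNgt; apply/negP => tN; apply: noN; exists N.
apply: (@dvg_harmonic R); rewrite -(is_cvg_series_restrict M.+1).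
apply: nondecreasing_is_cvgn.
  by apply: nondecreasing_series => n _ _; rewrite /= invr_ge0.
exists (e^-1 * limn (series t)) => _ [n _ <-] /=.
have st : {homo series t : n m / (n <= m)%N >-> n <= m}.
  by rewrite seriesEnat; apply: nondecreasing_series.
have := nondecreasing_cvgn_le st ct n.
rewrite -(ler_pM2l (_ : 0 < e^-1)) ?invr_gt0 //; apply: le_trans.
case: (leqP M.+1 n) => Mn; last first.
  by rewrite big_geq ?(ltnW Mn) // mulr_ge0 ?invr_ge0 ?(ltW e0) // seriesEnat /= sumr_ge0.
rewrite seriesEnat /= (big_cat_nat (leq0n M.+1) Mn) /= mulrDr -[leLHS]add0r.
apply: lerD; first by rewrite mulr_ge0 ?invr_ge0 ?(ltW e0) // sumr_ge0.
rewrite mulr_sumr; apply: ler_sum_nat => k /andP[Mk _].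
have k0 : 0 < k%:R :> R by rewrite ltr0n (leq_trans _ Mk).
(* The term [harmonic k] is $1/(k+1)$, which is at most $1/k$. *)
apply: (@le_trans _ _ k%:R^-1).
  by rewrite lef_pV2 ?posrE // ler_nat.
rewrite -(ler_pM2l k0) divff ?gt_eqF // mulrCA ler_pdivlMl // mulr1.
by rewrite big // ltnW.
Qed.

(** Algebra behind [clos_coef_rec]: [x] stands for $r_s$, [i] and [i'] for $1/r_s$ and $1/r_{s+1}$,
    and [W] for the tail after $s+1$. *)
Lemma clos_rec_identity (K : fieldType) (g g' d d' W i i' x : K) : x * i = 1 ->
  (g * d + x * ((d' - d) * i' * g' + W)) * i - (g' * d' * i' + W) =
  d * (g * i - g' * i').
Proof.
move=> xi.
transitivity (g * d * i + (x * i) * ((d' - d) * i' * g' + W) - (g' * d' * i' + W)).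
  by ring.
by rewrite xi; ring.
Qed.

Section Closure.
Context {R : realType}.
Local Notation C := (Cx R).
Variables (a : R) (d : nat -> C).
Hypothesis a_gtN1 : -1 < a.
Implicit Types (n k m s N : nat) (f g h y c x : nat -> C).
Local Notation r k := (((rnorm a k)%:C)%C : C).
Local Notation T := (op_in_H a (E_laguerre (a + 1) d)).

(** At [k = 0] the numerator is $d_0-d_0=0$, whereas [dprev] would give $d_0$. The closure formula
    only involves indices $k\ge1$, and one term does not affect membership in $\ell_2$. *)
Definition dquot k : C := (d k - d k.-1) / r k.
Hypothesis l2_dquot : l2 dquot.

Definition clos_tail g s : C :=
  limn (series (fun j => dquot (s + j.+1)%N * g (s + j.+1)%N) : nat -> C).

Lemma is_cvg_clos_tail g s : l2 g ->
  cvgn (series (fun j => dquot (s + j.+1)%N * g (s + j.+1)%N) : nat -> C).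
Proof.
by move=> lg; exact: (is_cvg_seriesM (@l2_shift _ _ s l2_dquot) (@l2_shift _ _ s lg)).
Qed.

Lemma clos_coefE g s : l2 g ->
  clos_coef a d g s = g s * d s + r s * clos_tail g s.
Proof.
move=> lg; rewrite /clos_coef; congr (_ + _).
apply: cvg_lim; first exact: norm_hausdorff.
rewrite (_ : series _ = (fun n => r s *
   series (fun j => dquot (s + j.+1)%N * g (s + j.+1)%N) n)).
  by apply: cvgM; [exact: cvg_cst|exact: is_cvg_clos_tail].
apply/funext => n; rewrite !seriesEnat /= mulr_sumr; apply: eq_bigr => j _.
by rewrite [RHS]mulrA; congr (_ * _); rewrite [RHS]mulrCA.
Qed.

Lemma clos_tailS g s : l2 g ->
  clos_tail g s = dquot s.+1 * g s.+1 + clos_tail g s.+1.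
Proof.
move=> lg; apply: cvg_lim; first exact: norm_hausdorff.
pose F j := dquot (s + j.+1)%N * g (s + j.+1)%N.
rewrite -(@cvg_shiftS _ (series F)).
have -> : [sequence series F n.+1]_n = (fun n => dquot s.+1 * g s.+1 +
   series (fun j => dquot (s.+1 + j.+1)%N * g (s.+1 + j.+1)%N) n).
  apply/funext => n; rewrite !seriesEnat /= big_nat_recl // /F addn1; congr (_ + _).
  by apply: eq_bigr => j _; rewrite addSnnS.
by apply: cvgD; [exact: cvg_cst|exact: is_cvg_clos_tail].
Qed.

(** Formally $g_s/r_s-g_{s+1}/r_{s+1}$ is the coefficient of $L_s^{(a+1)}$ in $g$, so this is the
    eigenvalue relation in coordinates. The infinite tails cancel in the difference. *)
Lemma clos_coef_rec g s : l2 g ->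
  clos_coef a d g s / r s - clos_coef a d g s.+1 / r s.+1 =
  d s * (g s / r s - g s.+1 / r s.+1).
Proof.
move=> lg; rewrite !clos_coefE // clos_tailS // [X in _ - X]mulrDl.
rewrite [r s.+1 * _]mulrC mulfK ?rnormC_neq0 //.
by apply: clos_rec_identity; rewrite divff ?rnormC_neq0.
Qed.

Lemma clos_coefB f g s : l2 f -> l2 g ->
  clos_coef a d (fun k => f k - g k) s = clos_coef a d f s - clos_coef a d g s.
Proof.
move=> lf lg; rewrite !clos_coefE //; last exact: l2B.
have -> : clos_tail (fun k => f k - g k) s = clos_tail f s - clos_tail g s.
  apply: cvg_lim; first exact: norm_hausdorff.
  rewrite (_ : series _ = (fun n =>
     series (fun j => dquot (s + j.+1)%N * f (s + j.+1)%N) n -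
     series (fun j => dquot (s + j.+1)%N * g (s + j.+1)%N) n)).
    by apply: cvgB; exact: is_cvg_clos_tail.
  apply/funext => n; rewrite !seriesEnat /= -sumrB; apply: eq_bigr => j _.
  by rewrite mulrBr.
by rewrite mulrBl mulrBr addrACA opprD.
Qed.

Lemma sqnorm_clos_coef_le s : exists K, forall g, l2 g ->
  sqnorm (clos_coef a d g s) <= K * l2sq g.
Proof.
(* The first summand bounds the diagonal term, the second the tail by Cauchy-Schwarz; the factor 2
   comes from [sqnormD_le]. *)
exists (2%:R * (sqnorm (d s) + rnorm a s ^+ 2 * l2sq dquot)) => g lg.
rewrite clos_coefE //; apply: le_trans (sqnormD_le _ _) _.
rewrite -mulrA ler_pM2l // mulrDl lerD //.
  by rewrite sqnormM mulrC ler_wpM2l ?sqnorm_ge0 // sqnorm_le_l2sq.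
rewrite sqnormM sqnorm_real -mulrA ler_wpM2l ?sqr_ge0 //.
apply: le_trans (CauchySchwarz_lim (@l2_shift _ _ s l2_dquot) (@l2_shift _ _ s lg)) _.
by apply: ler_pM; rewrite ?l2sq_ge0 ?l2sq_shift_le //; exact: l2_shift.
Qed.

(** After division by $r_s$, [y] and [clos_coef a d f] obey the same first-order recurrence and both
    vanish for $s\ge N$, so they agree everywhere. *)
Lemma clos_coef_graph f y : T f y -> [/\ l2 f, l2 y & y = clos_coef a d f].
Proof.
move=> /(op_in_H_E_laguerreP a_gtN1)[N [c [fE yE]]].
have f0 k : (N <= k)%N -> f k = 0 by move=> Nk; rewrite fE big_geq ?mul0r.
have y0 k : (N <= k)%N -> y k = 0 by move=> Nk; rewrite yE big_geq ?mul0r.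
have lf := l2_finite f0; split=> //; first exact: l2_finite y0.
pose e s := y s / r s - clos_coef a d f s / r s.
have eS s : e s = e s.+1.
  have yrec : y s / r s - y s.+1 / r s.+1 = d s * (f s / r s - f s.+1 / r s.+1).
    rewrite yE fE !mulfK ?rnormC_neq0 //; case: (ltnP s N) => sN.
      by rewrite !(@big_ltn _ _ _ s N) // !addrK.
    by rewrite !big_geq ?(leq_trans sN) // !subrr mulr0.
  have /eqP := etrans yrec (esym (clos_coef_rec s lf)).
  rewrite subr_eq /e => /eqP ->.
  by rewrite addrAC [_ / _ - _]addrC addrK addrC.
have e0 s : (N <= s)%N -> e s = 0.
  move=> Ns; rewrite /e y0 // mul0r sub0r clos_coefE // f0 // mul0r add0r.
  rewrite /clos_tail (@limn_eventually _ _ 0 0) ?mulr0 ?mul0r ?oppr0 // => n _.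
  rewrite seriesEnat /= big1 // => j _; rewrite f0 ?mulr0 //.
  by rewrite (leq_trans Ns) // leq_addr.
have eD s n : e s = e (s + n)%N.
  by elim: n => [|n IH]; rewrite ?addn0 // IH addnS eS.
apply/funext => s; have : e s = 0 by rewrite (eD s N) e0 // leq_addl.
by rewrite /e -mulrBl => /eqP; rewrite mulf_eq0 invr_eq0 (negPf (rnormC_neq0 _ _)) //
  orbF subr_eq0 => /eqP.
Qed.

Lemma closure_op_clos_coef g h : closure_op T g h -> h = clos_coef a d g.
Proof.
move=> [lg [lh [F [Y [FY [Fg Yh]]]]]]; apply/funext => s.
have lF n : l2 (fun k => F n k - g k).
  by apply: l2B => //; have [] := clos_coef_graph (FY n).
have lY n : l2 (fun k => Y n k - h k).
  by apply: l2B => //; have [] := clos_coef_graph (FY n).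
have {}Fg := (cvg0_l2norm lF).1 Fg; have {}Yh := (cvg0_l2norm lY).1 Yh.
have [K hK] := sqnorm_clos_coef_le s.
have le n : sqnorm (h s - clos_coef a d g s) <=
    2%:R * (l2sq (fun k => Y n k - h k) + K * l2sq (fun k => F n k - g k)).
  have [lFn _ YE] := clos_coef_graph (FY n).
  (* Inserting [Y n s], which equals [clos_coef a d (F n) s], splits the difference into two parts
     controlled by the two approximation errors. *)
  have -> : h s - clos_coef a d g s =
      clos_coef a d (fun k => F n k - g k) s - (Y n s - h s).
    by rewrite clos_coefB // -YE opprB [RHS]addrC addrA subrK.
  apply: le_trans (sqnormB_le _ _) _; rewrite ler_pM2l // addrC lerD ?hK //.
  exact: (sqnorm_le_l2sq s (lY n)).
apply/eqP; rewrite -subr_eq0; apply/eqP; apply: sqnorm_eq0.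
apply/eqP; rewrite eq_le sqnorm_ge0 andbT.
have lim0 : (fun n => 2%:R * (l2sq (fun k => Y n k - h k) +
    K * l2sq (fun k => F n k - g k))) @ \oo --> (0 : R).
  have z : 0 = 2%:R * (0 + K * 0) :> R by rewrite mulr0 addr0 mulr0.
  rewrite [X in _ --> X]z.
  by apply: cvgM; [exact: cvg_cst|apply: cvgD => //; apply: cvgM => //; exact: cvg_cst].
rewrite -(cvg_lim (@norm_hausdorff _ _) lim0); apply: limr_ge.
  by apply: cvgP lim0.
exact: nearW.
Qed.

(** Coordinates of the $L^{(a+1)}$-expansion of [x] cut at [N]. This differs from cutting the
    coordinates of [x]: the telescoping leaves the correction [x N / r N]. *)
Definition trunc N x k : C := if (k < N)%N then (x k / r k - x N / r N) * r k else 0.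

Lemma truncE N x k :
  trunc N x k = (\sum_(k <= n < N) (x n / r n - x n.+1 / r n.+1)) * r k.
Proof.
rewrite /trunc; case: ltnP => kN; last by rewrite big_geq // mul0r.
by rewrite (@sum_telescope_down _ _ _ (fun n => x n / r n)) // ltnW.
Qed.

(** By [clos_coef_rec] the expansion coefficients of the image are $d_n$ times those of [g], so
    truncation commutes with the formal action. *)
Lemma trunc_graph N g : l2 g -> T (trunc N g) (trunc N (clos_coef a d g)).
Proof.
move=> lg; apply/(op_in_H_E_laguerreP a_gtN1).
exists N, (fun n => g n / r n - g n.+1 / r n.+1); split; apply/funext => k.
  exact: truncE.
by rewrite truncE; congr (_ * _); apply: eq_bigr => n _; rewrite clos_coef_rec.
Qed.

Lemma l2_truncB N x : l2 x -> l2 (fun k => trunc N x k - x k).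
Proof.
move=> lx; apply: l2B => //; apply: (@l2_finite _ _ N) => k Nk.
by rewrite /trunc ltnNge Nk.
Qed.

(* The error of the truncation is [x N / r N] times the first [N] weights, plus
   the tail of [x]; the weights sum up to [N r_N^2 / (a + 1)]. *)
Lemma l2sq_truncB_le N x : l2 x ->
  l2sq (fun k => trunc N x k - x k) <=
  (a + 1)^-1 * (N%:R * sqnorm (x N)) +
  (l2sq x - series (fun k => sqnorm (x k)) N).
Proof.
move=> lx; apply: l2sq_le; first exact: l2_truncB.
(* Partial sums increase, so [n] may be raised above [N] and the sum split there. *)
move=> n; apply: le_trans (series_sqnorm_homo _ (leq_maxl n N)) _.
have Nm := leq_maxr n N; move: (maxn n N) Nm => m Nm.
pose S n := series (fun k => sqnorm (x k)) n.
have -> : l2sq x - S N = (S m - S N) + (l2sq x - S m) by ring.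
rewrite addrA -[leLHS]addr0; apply: lerD; last first.
  by rewrite subr_ge0 series_le_l2sq.
rewrite sub_series_geq // seriesEnat /= (big_cat_nat (leq0n N) Nm) /=.
rewrite le_eqVlt; apply/orP; left; apply/eqP; congr (_ + _); last first.
  apply: eq_big_nat => k /andP[Nk _].
  by rewrite /trunc ltnNge Nk /= sub0r sqnormN.
rewrite (eq_big_nat _ _ (F2 := fun k => rnorm a k ^+ 2 * sqnorm (x N / r N))).
  have xE : sqnorm (x N) = sqnorm (x N / r N) * rnorm a N ^+ 2.
    by rewrite -sqnorm_real -sqnormM divfK ?rnormC_neq0.
  by rewrite -mulr_suml sum_rnorm_sq // xE; ring.
move=> k /andP[_ kN]; rewrite /trunc kN mulrBl divfK ?rnormC_neq0 //.
by rewrite addrAC subrr sub0r sqnormN (sqnormM _ (r k)) (sqnorm_real (rnorm a k)) mulrC.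
Qed.

Lemma clos_coef_closure g : l2 g -> l2 (clos_coef a d g) ->
  closure_op T g (clos_coef a d g).
Proof.
move=> lg; set h := clos_coef a d g => lh; do 2 split=> //.
have a1 : 0 < a + 1 by move: a_gtN1; lra.
have ct : cvgn (series (fun k => sqnorm (g k) + sqnorm (h k))).
  exact: (is_cvg_seriesD lg lh).
have t0 k : 0 <= sqnorm (g k) + sqnorm (h k) by rewrite addr_ge0 ?sqnorm_ge0.
(* Selecting along the sum of both squared moduli yields one sequence of cut-offs that serves [g]
   and [h] at once. *)
have /choice[N hN] i : exists n, (i <= n)%N /\
    n%:R * (sqnorm (g n) + sqnorm (h n)) < i.+1%:R^-1.
  have i0 : 0 < i.+1%:R^-1 :> R by rewrite invr_gt0.
  by have [n] := liminf_natmul_summable t0 ct i i0; exists n.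
have main x : l2 x -> (forall k, sqnorm (x k) <= sqnorm (g k) + sqnorm (h k)) ->
    (fun i => l2norm (fun k => trunc (N i) x k - x k)) @ \oo --> (0 : R).
  move=> lx xle; apply/cvg0_l2norm => [i|]; first exact: l2_truncB.
  (* Since [i <= N i], the tail beyond [N i] is at most the tail beyond [i]. *)
  have up : (fun i => (a + 1)^-1 * harmonic i +
      (l2sq x - series (fun k => sqnorm (x k)) i)) @ \oo --> (0 : R).
    have z : 0 = (a + 1)^-1 * 0 + (l2sq x - l2sq x) by rewrite mulr0 subrr addr0.
    rewrite [X in _ --> X]z; apply: cvgD.
      by apply: cvgM; [exact: cvg_cst|exact: cvg_harmonic].
    by apply: cvgB => //; exact: cvg_cst.
  apply: (squeeze_cvgr _ (cvg_cst 0) up); apply: nearW => i.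
  have [iN Ni] := hN i; rewrite l2sq_ge0 /=; last exact: l2_truncB.
  apply: le_trans (l2sq_truncB_le _ lx) _; apply: lerD.
    rewrite ler_pM2l ?invr_gt0 //; apply: le_trans (ltW Ni).
    by rewrite ler_wpM2l.
  by rewrite lerD2l lerN2 series_sqnorm_homo.
exists (fun i => trunc (N i) g), (fun i => trunc (N i) h).
split=> [i|]; first exact: trunc_graph.
by split; apply: main => // k; rewrite ?lerDl ?lerDr sqnorm_ge0.
Qed.

Lemma closure_opP g h : closure_op T g h <-> l2 g /\ l2 h /\ h = clos_coef a d g.
Proof.
split=> [cl|[lg [lh hE]]].
  by have [lg [lh _]] := cl; rewrite -(closure_op_clos_coef cl).
by rewrite hE in lh *; exact: clos_coef_closure.
Qed.

End Closure.

(** * Consequences for basis vectors and for the differential operator *)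

Lemma m_eigenvalue_diff (K : comNzRingType) (k : nat) :
  (- 2%:R * k.+1%:R + 1) - (- 2%:R * k%:R + 1) = - 2%:R :> K.
Proof. by rewrite -natr1; ring. Qed.

Section Conclusion.
Context {R : realType}.
Local Notation C := (Cx R).
Variable a : R.
Hypothesis a_gtN1 : -1 < a.
Local Notation r k := (((rnorm a k)%:C)%C : C).

Lemma adj_coef_basisvec (d : nat -> C) s k : (s < k)%N ->
  adj_coef a d (basisvec s) k =
  r s * ((conjc (d k) - conjc (dprev d k)) / r k).
Proof.
move=> sk; rewrite /adj_coef {1}/basisvec gtn_eqF // mulr0 add0r.
rewrite (bigD1 (Ordinal sk)) //= big1 => [|t ts].
  by rewrite /basisvec eqxx mulr1 addr0 [RHS]mulrCA.
rewrite /basisvec; case: eqP => [E|_]; last by rewrite !mulr0 mul0r mulr0.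
by case/eqP: ts; apply: val_inj.
Qed.

(** Beyond [s] the two sequences differ by the nonzero constant factor $r_s$, which makes the
    condition independent of [s]. *)
Lemma l2_adj_coef_basisvec (d : nat -> C) s :
  l2 (adj_coef a d (basisvec s)) <->
  l2 (fun k => (conjc (d k) - conjc (dprev d k)) / r k).
Proof.
split=> [l|l].
  apply: (@l2_eventually _ (fun k => (r s)^-1 * adj_coef a d (basisvec s) k) _ s.+1).
    by move=> k sk; rewrite adj_coef_basisvec // mulKf // rnormC_neq0.
  by apply: (l2_le l) => k; rewrite sqnormM.
apply: (@l2_eventually _ (fun k => r s *
    ((conjc (d k) - conjc (dprev d k)) / r k)) _ s.+1).
  by move=> k sk; rewrite adj_coef_basisvec.
by apply: (l2_le l) => k; rewrite sqnormM.
Qed.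

(** Conjugation preserves moduli, and [d k.-1] agrees with [dprev d k] from index 1 on. *)
Lemma l2_dquot (d : nat -> C) :
  l2 (fun k => (conjc (d k) - conjc (dprev d k)) / r k) -> l2 (dquot a d).
Proof.
move=> l; apply: (@l2_eventually _
    (fun k => (d k - dprev d k) / r k) _ 1) => [[//|k] _ //|].
apply: (l2_le (K := 1) l) => k.
by rewrite mul1r !sqnormM -conjCB sqnorm_conj.
Qed.

(** The second term is a nonnegative remainder that decreases by exactly $r_n^{-2}$ at each step, so
    the partial sums are bounded by $a/(a-1)$. *)
Lemma sum_inv_rnorm_sq n : 1 < a ->
  \sum_(0 <= k < n) (rnorm a k ^+ 2)^-1 +
  (n%:R + a) / (a - 1) * (rnorm a n ^+ 2)^-1 = a / (a - 1).
Proof.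
move=> a1; have a1' : a - 1 != 0 by rewrite subr_eq0 gt_eqF.
elim: n => [|n IH].
  by rewrite big_nil add0r /rnorm big_ord0 fact0 divr1 sqrtr1 expr1n invr1 mulr1 add0r.
rewrite big_nat_recr //= -[RHS]IH -addrA; congr (_ + _).
have rn k : rnorm a k ^+ 2 != 0 by rewrite expf_neq0 // gt_eqF // rnorm_gt0.
have an : a + n.+1%:R != 0 by rewrite gt_eqF // ltr_wpDr // (lt_trans _ a1).
have n1 : n.+1%:R != 0 :> R by [].
have -> : rnorm a n.+1 ^+ 2 = (a + n.+1%:R) * rnorm a n ^+ 2 / n.+1%:R.
  by rewrite -rnorm_sqS // mulrC mulKf.
move: (rn n) an n1; rewrite -[n.+1%:R]natr1.
move: (rnorm a n ^+ 2) (n%:R : R) => q t q0 at0 t0.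
by field; rewrite a1' q0 at0 t0.
Qed.

Lemma l2_dquot_m_op : 1 < a -> l2 (dquot a (fun n => - 2%:R * n%:R + 1)).
Proof.
move=> a1; apply: (@l2_eventually _ (fun k => - 2%:R / r k) _ 1).
  move=> [//|k] _; rewrite /dquot /=; congr (_ / _).
  exact: (esym (m_eigenvalue_diff _ k)).
have sq k : sqnorm (- 2%:R / r k) = sqnorm (- 2%:R : C) * (rnorm a k ^+ 2)^-1.
  rewrite sqnormM; congr (_ * _).
  have <- : ((((rnorm a k)^-1)%:C)%C : C) = (r k)^-1.
    exact: (fmorphV (real_complex R)).
  by rewrite sqnorm_real exprVn.
apply/l2P; exists (sqnorm (- 2%:R : C) * (a / (a - 1))) => n.
rewrite seriesEnat /= (eq_bigr _ (fun k _ => sq k)) -mulr_sumr.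
rewrite ler_wpM2l ?sqnorm_ge0 // -(sum_inv_rnorm_sq n a1) lerDl.
by rewrite !mulr_ge0 ?invr_ge0 ?sqr_ge0 ?subr_ge0 ?(ltW a1) // addr_ge0 // ltW // (lt_trans _ a1).
Qed.

Lemma m_coefE (g : nat -> C) :
  m_coef a g = clos_coef a (fun n => - 2%:R * n%:R + 1) g.
Proof.
apply/funext => s; rewrite /m_coef /clos_coef; congr (_ + limn (series _)).
apply/funext => j /=; congr (_ * _ * _).
by rewrite addnS; exact: (esym (m_eigenvalue_diff _ (s + j))).
Qed.

End Conclusion.

Theorem theorem3 (R : realType) (a : R) (d : nat -> Cx R) :
  -1 < a -> Dtilde d ->
  let T := op_in_H a (E_laguerre (a + 1) d) in
  let dd := fun k => (conjc (d k) - conjc (dprev d k)) / ((rnorm a k)%:C)%C in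
  (* (i) *)
  (forall g, l2 g -> (dom (adjoint T) g <-> l2 (adj_coef a d g))) /\
  (* (ii) *)
  (forall g, dom (adjoint T) g ->
     forall h, adjoint T g h <-> h = adj_coef a d g) /\
  (* (iii) *)
  (forall s : nat, dom (adjoint T) (basisvec s) <-> l2 dd) /\
  (* (iv) *)
  (l2 dd ->
     closable T /\
     (forall g, l2 g -> (dom (closure_op T) g <-> l2 (clos_coef a d g))) /\
     (forall g, dom (closure_op T) g ->
        forall h, closure_op T g h <-> h = clos_coef a d g)) /\
  (* (v) *)
  (1 < a ->
     let M := op_in_H a (fun p q => q = m_op a p) in
     (forall g, l2 g -> (dom (closure_op M) g <-> l2 (m_coef a g))) /\
     (forall g, dom (closure_op M) g ->
        forall h, closure_op M g h <-> h = m_coef a g)).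
Proof.
move=> a_gtN1 _ T dd.
(* The adjoint and both closures have graphs of this one shape, from which the domain and value
   statements follow uniformly. *)
have domP (A : opgraph) (co : (nat -> Cx R) -> nat -> Cx R) :
    (forall g h, A g h <-> l2 g /\ l2 h /\ h = co g) ->
    (forall g, l2 g -> (dom A g <-> l2 (co g))) /\
    (forall g, dom A g -> forall h, A g h <-> h = co g).
  move=> AP; split=> [g lg|g [h0 /AP[lg [lh0 h0E]]] h].
    split=> [[h /AP[_ [lh <-]]] //|lh].
    by exists (co g); apply/AP.
  split=> [/AP[_ [_ ->]] //|->]; apply/AP.
  by rewrite h0E in lh0.
have [i ii] := domP _ _ (adjointP d a_gtN1).
split=> //; split=> //; split=> [s|].
  have ls : l2 (basisvec s : nat -> Cx R).
    by apply: (@l2_finite _ _ s.+1) => k sk; rewrite /basisvec gtn_eqF.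
  exact: iff_trans (i _ ls) (l2_adj_coef_basisvec a_gtN1 d s).
split=> [ldd|a1 M].
  have cl := closure_opP a_gtN1 (l2_dquot ldd).
  split; last exact: (domP _ _ cl).
  by move=> g h1 h2 /cl[_ [_ ->]] /cl[_ [_ ->]].
have cl := closure_opP a_gtN1 (l2_dquot_m_op a_gtN1 a1).
apply: (domP _ (m_coef a)) => g h; rewrite m_coefE.
suff -> : M = op_in_H a (E_laguerre (a + 1) (fun n => - 2%:R * n%:R + 1)) by exact: cl.
apply/funext => f; apply/funext => y; apply/propext.
exact: op_in_H_m_op.
Qed.
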